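(* Let $G$ be a finite non-abelian solvable group. Suppose that every irreducible complex character of $G$ vanishes on elements of prime power order only, i.e. whenever $\chi\in\mathrm{Irr}(G)$ and $g\in G$ satisfy $\chi(g)=0$, the order of $g$ is a power of a prime. Then there exist distinct primes $p$ and $q$ such that one of the following holds: (i) $G$ is a $p$-group; (ii) $G/\mathbf{Z}(G)$ is a Frobenius group with a Frobenius complement of $p$-power order and $\mathbf{Z}(G)=\mathbf{O}_{p}(G)$; (iii) $G$ is a Frobenius group with a Frobenius complement of $p$-power order and a kernel of $q$-power order, that is, $\pi(G)=\{p,q\}$; (iv) $G$ is a nearly $2$-Frobenius group and $\pi(G)=\{p,q\}$.
   Context: $\mathrm{Irr}(G)$ is the set of complex irreducible characters of $G$; $\pi(G)$ is the set of prime divisors of $|G|$; $\mathbf{Z}(G)$ is the center of $G$; $\mathbf{O}_{p}(G)$ is the largest normal $p$-subgroup of $G$. A group $G$ is a $2$-Frobenius group if there exist two normal subgroups $F$ and $L$ of $G$ such that $G/F$ is a Frobenius group with kernel $L/F$ and $L$ is a Frobenius group with kernel $F$. A group $G$ is a nearly $2$-Frobenius group if there exist two normal subgroups $F$ and $L$ of $G$ with the following properties: $F=F_{1}\times F_{2}$ is nilpotent, where $F_{1}$ and $F_{2}$ are normal subgroups of $G$; furthermore, $G/F$ is a Frobenius group with kernel $L/F$, $G/F_{1}$ is a Frobenius group with kernel $L/F_{1}$, and $G/F_{2}$ is a $2$-Frobenius group. *)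

(* Defs.v *)
From mathcomp Require Import all_boot all_fingroup all_algebra all_solvable.

Set Implicit Arguments.
Unset Strict Implicit.
Unset Printing Implicit Defensive.

Import GroupScope.

(* F \subset L need not be stated: it is part of L being Frobenius with
   kernel F. *)
Definition two_Frobenius (gT : finGroupType) (G : {set gT}) : Prop :=
  exists F L : {group gT},
    [/\ F <| G, L <| G,
        [Frobenius G / F with kernel L / F]
      & [Frobenius L with kernel F]].

(* F \subset L has to be explicit: without it, L / F denotes the image of L
   in G / F. F1 and F2 are not required to be nontrivial. *)
Definition nearly_two_Frobenius (gT : finGroupType) (G : {set gT}) : Prop :=
  exists F L F1 F2 : {group gT},
    [/\ [/\ F <| G, L <| G & F \subset L],
        [/\ F1 <| G, F2 <| G, F1 \x F2 = F & nilpotent F],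
        [Frobenius G / F with kernel L / F],
        [Frobenius G / F1 with kernel L / F1]
      & two_Frobenius (G / F2)].

(* Main.v *)
Require Import Defs.
From mathcomp Require Import all_boot all_fingroup all_algebra all_solvable.
From mathcomp Require Import all_field all_character.

(* For G solvable and not nilpotent put F = F(G).  If x is not in F and xF is
   central in F(G/F), then x is a zero of some irreducible character: a linear
   character of F/F' whose inertia group in the preimage of the center Z of
   F(G/F) is as small as possible has inertia group F there, so it induces
   irreducibly and every character of G above it vanishes at x.  Since zeros
   lift from quotients, the whole coset xF then consists of elements of prime
   power order; hence F(G/F) is an s-group, Z acts without fixed points on the
   s'-part of F, and so Z is cyclic.

   If G/F is nilpotent, it is a p-group and all elements of G outside F are
   p-elements, which gives (ii).  (Case (iii) is the part of (ii) where Z(G) = 1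
   and the kernel is a q-group, so it is never needed.)  Otherwise let u be the
   prime of the next Fitting factor.  A Frobenius group of order s * u then acts
   on F with every nontrivial element acting freely on the {s, u}'-part of F;
   this makes that part trivial, and gives u | s - 1.  Applied to both G and
   G/F, this descent of primes rules out Fitting height 4, and at height 3 it
   makes s odd, so that F(G/F) is cyclic and (iv) holds. *)

Set Implicit Arguments.
Unset Strict Implicit.
Unset Printing Implicit Defensive.

Import GroupScope GRing.Theory.

(** * Zeros of irreducible characters and their lifting from quotients *)

Definition vanishing (gT : finGroupType) (G : {group gT}) (g : gT) : Prop :=
  exists i : Iirr G, ('chi_i g = 0)%R.

Definition ppower_elt (gT : finGroupType) (g : gT) : Prop :=
  exists2 r : nat, prime r & r.-elt g.

Definition ppower_vanishing (gT : finGroupType) (G : {group gT}) : Prop :=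
  forall g, g \in G -> vanishing G g -> ppower_elt g.

Lemma vanishing_quotient (gT : finGroupType) (G N : {group gT}) g :
  N <| G -> g \in G -> vanishing (G / N) (coset N g) -> vanishing G g.
Proof.
move=> nsNG Gg [i chi0]; exists (mod_Iirr i).
by rewrite mod_IirrE // cfModE.
Qed.

Lemma ppower_vanishing_quotient (gT : finGroupType) (G N : {group gT}) :
  N <| G -> ppower_vanishing G -> ppower_vanishing (G / N).
Proof.
move=> nsNG vG _ /morphimP[g Ng Gg ->] /(vanishing_quotient nsNG Gg)/(vG g Gg).
by case=> r pr_r rg; exists r => //; apply: morph_p_elt.
Qed.

(** * Zeros from Schur's lemma and central commutators *)

Section CharacterZeros.

Import Num.Theory.

Local Open Scope ring_scope.

(** By Schur's lemma the sum [M] of the matrices of [N] is scalar. Since [M] absorbs each [rG n], a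
    nonzero scalar would put [N] in the kernel; so [M] is zero, and the coset sum is the trace of
    [rG x *m M]. *)
Lemma sum_irr_coset (gT : finGroupType) (G N : {group gT}) i x :
  N <| G -> ~~ (N \subset cfker 'chi[G]_i) -> x \in G ->
  \sum_(n in N) 'chi_i (x * n)%g = 0.
Proof.
move=> nsNG; have [sNG nNG] := andP nsNG.
rewrite -irrRepr cfker_repr => nkerN Gx; set rG := 'Chi_i in nkerN *.
pose M := \sum_(n in N) rG n.
have /is_scalar_mxP[c Mc] : is_scalar_mx M.
  apply: (mx_abs_irr_cent_scalar (rG := rG)); first exact/groupC/socle_irr.
  apply/centgmxP=> g Gg; rewrite mulmx_suml mulmx_sumr.
  rewrite [RHS](reindex_inj (conjg_inj g)) /=.
  apply: eq_big => n; first by rewrite memJ_norm ?(subsetP nNG).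
  move=> Nn; have Gn := subsetP sNG n Nn.
  by rewrite -!repr_mxM ?groupJ // conjgC.
have McK n : n \in N -> M *m rG n = M.
  move=> Nn; rewrite mulmx_suml [RHS](reindex_inj (mulIg n)) /=.
  apply: eq_big => m; first by rewrite groupMr.
  by move=> Nm; rewrite repr_mxM // (subsetP sNG).
have c0: c = 0.
  apply: contraNeq nkerN => nz_c; apply/subsetP=> n Nn.
  rewrite inE (subsetP sNG) // mul1mx; apply/eqP.
  have := McK n Nn; rewrite Mc mul_scalar_mx -[in RHS]scalemx1.
  by move/(scalerI nz_c).
rewrite (eq_bigr (fun n => \tr (rG x *m rG n))) => [|n Nn].
  by rewrite -raddf_sum -mulmx_sumr -/M Mc c0 raddf0 mulmx0 raddf0.
by have Gn := subsetP sNG n Nn; rewrite cfunE groupM // mulr1n repr_mxM.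
Qed.

Lemma irr_notin_cfker (gT : finGroupType) (G : {group gT}) x :
  x != 1%g -> exists i : Iirr G, x \notin cfker 'chi_i.
Proof.
move=> ntx; apply/existsP; apply: contraR ntx.
rewrite negb_exists => /forallP kerx.
rewrite -in_set1 -[[set 1%g]]/[1 gT]%g -(TI_cfker_irr G); apply/bigcapP=> i _.
by have:= kerx i; rewrite negbK.
Qed.

(* Since [z] is central in [Q], the powers of [k] conjugate [x] to all the
   [x * z ^+ j], so [chi] is constant on the coset [x <[z]>]; it also sums to
   zero there as soon as [z] is not in the kernel. *)
Lemma commutator_vanishing (gT : finGroupType) (G Q : {group gT}) x k :
    Q <| G -> x \in Q -> k \in Q -> [~ x, k]%g \in ('Z(Q))%g ->
    [~ x, k]%g != 1%g -> (<[ [~ x, k] ]> <| G)%g -> vanishing G x.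
Proof.
move=> nsQG Qx Qk; set z := [~ x, k]%g => Zz ntz nszG.
have sQG := subsetP (normal_sub nsQG).
have [i kerz] := irr_notin_cfker G ntz.
exists i; have nkerz: ~~ (<[z]>%g \subset cfker 'chi_i) by rewrite cycle_subG.
have := sum_irr_coset nszG nkerz (sQG x Qx).
rewrite (eq_bigr (fun=> 'chi_i x)) => [|_ /cycleP[j ->]].
  rewrite sumr_const => /eqP; rewrite -mulr_natl mulf_eq0 pnatr_eq0.
  by rewrite -[_ == 0%N]negbK -lt0n cardG_gt0 => /eqP.
have [_ cQz] := setIP Zz.
have ->: (x * z ^+ j = x ^ (k ^+ j))%g.
  elim: j => [|j IHj]; first by rewrite !expg0 mulg1 conjg1.
  rewrite expgSr [in RHS]expgSr conjgM -IHj conjMg conjXg /conjg.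
  have ->: (k^-1 * (x * k) = x * z)%g by rewrite /z commgEl mulKVg.
  have czk: commute k z by apply/esym/(centP cQz).
  by rewrite -czk mulKg -mulgA -expgS expgSr.
by rewrite cfunJ ?sQG // groupX.
Qed.

End CharacterZeros.

(** Climb the upper central series to the last term ['Z_n.+1(G)] missing [x]. Modulo ['Z_n(G)], [x]
    is not central but its commutators are, so [commutator_vanishing] applies there. *)
Lemma nilpotent_vanishing (gT : finGroupType) (G : {group gT}) x :
  nilpotent G -> x \in G -> x \notin 'Z(G) -> vanishing G x.
Proof.
move=> /ucnP[n Zn] Gx.
have: x \in 'Z_n(G) by rewrite Zn.
elim: n {Zn} => [|[|n] IHn]; first by rewrite ucn0 => /set1P->; rewrite group1.
  by rewrite ucn1 => ->.
have [Znx _ | nZnx Zn1x _] := boolP (x \in 'Z_n.+1(G)).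
  exact: IHn.
have nsZ := ucn_normal n G; have nZ := subsetP (normal_norm nsZ).
apply: (vanishing_quotient (ucn_normal n G)) => //=.
have Qx: coset 'Z_n(G) x \in G / 'Z_n(G) by rewrite mem_quotient.
have nZx: coset 'Z_n(G) x \notin 'Z(G / 'Z_n(G)).
  apply: contra nZnx => Zx.
  by rewrite ucnSn mem_morphpre // nZ.
have /subsetPn[_ /morphimP[k Nk Gk ->] ncxk]:
    ~~ (G / 'Z_n(G) \subset 'C[coset 'Z_n(G) x]).
  by apply: contra nZx => cx; rewrite inE Qx /= -sub_cent1.
have ntz: [~ coset 'Z_n(G) x, coset 'Z_n(G) k] != 1.
  by apply: contra ncxk => /commgP cxk; apply/cent1P.
have Zz: [~ coset 'Z_n(G) x, coset 'Z_n(G) k] \in 'Z(G / 'Z_n(G)).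
  rewrite -morphR ?nZ //= -ucn_central mem_quotient //.
  by apply: (subsetP (ucn_comm n.+1 G)); rewrite mem_commg.
apply: (commutator_vanishing (normal_refl _) Qx (mem_quotient _ Gk) Zz ntz).
by apply: sub_center_normal; rewrite cycle_subG.
Qed.

(** * Zeros from Clifford theory over the Fitting subgroup *)

(** The character induced to [A] is irreducible, and any irreducible character of [G] above it
    restricts to a multiple of the sum of its conjugates, all of which vanish off the normal
    subgroup [V]. *)
Lemma inertia_vanishing (gT : finGroupType) (G A V : {group gT}) i x :
    A <| G -> V <| G -> V \subset A -> 'I_A[('chi[V]_i)%R] \subset V ->
    x \in A -> x \notin V ->
  vanishing G x.
Proof.
move=> nsAG nsVG sVA sIV Ax nVx.
have nsVA := normalS sVA (normal_sub nsAG) nsVG.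
have defI: 'I_A[('chi_i)%R]%G = V.
  by apply/val_inj/eqP; rewrite eqEsubset sIV sub_Inertia.
have [irrInd _ _ _ _] := constt_Inertia_bijection i nsVA.
have /irrP[k def_k] : ('Ind[A] 'chi_i)%R \in irr A.
  by move: irrInd; rewrite defI cfInd_id; apply; rewrite constt_irr inE.
have [j Gkj] := constt_cfInd_irr k (normal_sub nsAG).
exists j; rewrite -(cfResE _ (normal_sub nsAG)) //.
rewrite (Clifford_Res_sum_cfclass nsAG (j := k)); last first.
  by rewrite -constt_Ind_Res.
rewrite cfunE sum_cfunE big1_seq ?mulr0 // => _ /andP[_ /cfclassP[y Gy ->]].
have nAy := subsetP (normal_norm nsAG) y Gy.
rewrite cfConjgE // -def_k (cfun_on0 (cfInd_normal _ nsVA)) //.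
by rewrite memJ_norm // groupV (subsetP (normal_norm nsVG)).
Qed.

Lemma constt_notin (gT : finGroupType) (H : {group gT}) y :
  y \notin H -> exists2 r, prime r & y.`_r \notin H.
Proof.
move=> nHy; have /hasP[r _ nHyr]:
    has (fun r : nat => y.`_(r : nat_pred) \notin H) (index_iota 0 #[y].+1).
  apply: contraR nHy => /hasPn Hy; rewrite -[y]prod_constt big_seq.
  by apply: group_prod => r /Hy; rewrite negbK.
exists r => //; apply: contraR nHyr => pr'r.
rewrite (constt1P _) ?group1 // /p_elt p'natEpi // mem_primes.
by rewrite (negPf pr'r).
Qed.


Lemma coprime_cent_prod (gT : finGroupType) (A G : {group gT}) :
    A \subset 'N(G) -> coprime #|G| #|A| -> solvable G ->
  [~: G, A] * 'C_G(A) = G.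
Proof.
move=> nGA coGA solG; have sRG: [~: G, A] \subset G by rewrite commg_subl.
have nRG: G \subset 'N([~: G, A]) by rewrite commg_norml.
apply/eqP; rewrite eqEsubset mul_subG ?subsetIl //= -quotientSK //=.
rewrite coprime_quotient_cent ?commg_normr //.
by rewrite subsetI subxx quotient_cents2r.
Qed.

(* If an [r]-element [x] outside [V] fixes [chi_i], then [chi_i] is trivial on
   [D = [~: E, <[x]>]] where [E = 'O_r^'(V)]; multiplying it by a nontrivial
   character of [V] trivial on a complement of [D] strictly shrinks the inertia
   group. *)
Lemma regular_linear_char (gT : finGroupType) (A V : {group gT}) :
    V <| A -> abelian V -> abelian (A / V) ->
    (forall r x, prime r -> x \in A -> r.-elt x -> x \notin V ->
       x \notin 'C('O_r^'(V))) ->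
  exists i, 'I_A[('chi[V]_i)%R] \subset V.
Proof.
move=> nsVA abV abAV nCV; have [sVA nVA] := andP nsVA.
have lin i : ('chi[V]_i)%R \is a linear_char by apply/char_abelianP.
pose inertia_card (i : Iirr V) := #|'I_A[('chi_i)%R]|.
case: (@arg_minnP _ (0%R : Iirr V) xpredT inertia_card) => // i _ min_i.
exists i; apply/subsetPn=> [[y Iy nVy]].
have [r pr_r nVx] := constt_notin nVy.
set x := y.`_r in nVx; have rx: r.-elt x by apply: p_elt_constt.
have Ix: x \in 'I_A[('chi_i)%R] by apply: groupX.
have [Ax _] := setIP Ix.
set E := 'O_r^'(V); have nCx : x \notin 'C(E) by apply: (nCV r).
have nEA: A \subset 'N(E) := gFnorm_trans _ nVA.
have sEV : E \subset V := pcore_sub _ _.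
set X := <[x]>; have nEX: X \subset 'N(E) by rewrite cycle_subG (subsetP nEA).
have coEX: coprime #|E| #|X|.
  rewrite coprime_sym; apply: (pnat_coprime rx); exact: pcore_pgroup.
set D := [~: E, X].
have sDE: D \subset E by rewrite commg_subl.
have abE: abelian E := abelianS sEV abV.
have defE: D * 'C_E(X) = E by apply: coprime_cent_prod; rewrite ?abelian_sol.
(* [C] supplements [D] in [V], and it is proper since otherwise [x] would centralize [E]. So some
   nontrivial [chi_j] has [C] in its kernel. *)
pose C := 'O_r(V) <*> 'C_E(X).
have abCV: C \subset V by rewrite join_subG pcore_sub subIset ?sEV.
have nsCV: C <| V by rewrite /normal abCV (subset_trans abV) ?cents_norm ?centS.
have defOE: 'O_r(V) * E = V by case/dprodP: (nilpotent_pcoreC r (abelian_nil abV)).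
have defC: C = 'O_r(V) * 'C_E(X).
  apply: cent_joinEr; rewrite (subset_trans (subset_trans (subsetIl _ _) sEV)) //.
  by rewrite (subset_trans abV) // centS ?pcore_sub.
have defV: D * C = V.
  rewrite defC mulgA (normC (subset_trans (subset_trans sDE sEV) (gFnorm _ _))).
  by rewrite -mulgA defE.
have ltCV: C != V.
  apply: contraNneq nCx => defV'; rewrite -sub_cent1 -cent_cycle.
  have: E \subset C by rewrite defV'.
  rewrite defC => /setIidPl <-; rewrite -group_modr ?subsetIl //.
  by rewrite setIC TI_pcoreC mul1g subsetIr.
have [v Vv nCv]: exists2 v, v \in V & v \notin C.
  by apply/subsetPn; apply: contra ltCV => sVC; rewrite eqEsubset abCV.
have ntv: coset C v != 1.
  by rewrite (sameP eqP (kerP _ _)) ?ker_coset // (subsetP (normal_norm nsCV)).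
have [i1 kerv] := irr_notin_cfker (V / C) ntv.
pose j := mod_Iirr i1.
have kerj: C \subset cfker ('chi_j)%R by rewrite mod_IirrE ?cfker_mod.
have nz_j: j != 0%R.
  rewrite mod_Iirr_eq0 //; apply: contraNneq kerv => ->.
  by rewrite cfker_irr0 mem_quotient.
have sXA: X \subset A by rewrite cycle_subG.
have cVV u w : u \in V -> w \in V -> commute u w by move=> Vu; apply: (centsP abV).
(* As [A / V] is abelian, conjugation by [A] changes elements of [X] only by factors in [V], which
   act trivially on the abelian [V]. This is what makes [C] and [D] invariant under [A]. *)
have XJ h a: h \in X -> a \in A -> exists2 u, u \in V & h ^ a = h * u.
  move=> Xh Aa; exists [~ h, a]; last by rewrite commgEl mulKVg.
  apply: (subsetP (der1_min nVA abAV)).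
  by apply: mem_commg => //; apply: (subsetP sXA).
have EJ e a: e \in E -> a \in A -> e ^ a \in E.
  by move=> Ee Aa; rewrite memJ_norm ?(subsetP nEA).
have nCA a c: a \in A -> c \in C -> c ^ a \in C.
  rewrite defC => Aa /mulsgP[o e Oo /setIP[Ee cXe] ->]; rewrite conjMg.
  have nOa: a \in 'N('O_r(V)) by rewrite (subsetP (gFnorm_trans _ nVA)).
  apply: mem_mulg; first by rewrite memJ_norm.
  rewrite inE EJ //= cent_cycle; apply/cent1P.
  have [u Vu xa] := XJ x a (cycle_id x) Aa.
  have ->: x = x ^ a * u^-1 by rewrite xa mulgK.
  apply: commuteM; last by apply: cVV; rewrite ?groupV // (subsetP sEV) ?EJ.
  by rewrite /commute -!conjMg (centP cXe) // cycle_id.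
have nDA a d: a \in A -> d \in D -> d ^ a \in D.
  move=> Aa; rewrite -mem_conjgV; move: d; apply/subsetP.
  rewrite -sub_conjg -genJ gen_subG sub_conjg; apply/subsetP => _ /imset2P[e h Ee Xh ->].
  rewrite mem_conjgV conjRg; have [u Vu ->] := XJ h a Xh Aa.
  have Veh: [~ e ^ a, h] \in V.
    by rewrite (subsetP sEV) // (subsetP sDE) // mem_commg ?EJ.
  have /commgP/eqP Veu := cVV _ _ (subsetP sEV _ (EJ e a Ee Aa)) Vu.
  by rewrite commgMJ Veu mul1g /conjg (cVV _ u) // mulKg mem_commg ?EJ.
(* A linear character fixed by [X] agrees at [e] and [e ^ h], so it kills the generators of [D]. *)
have kerD m : (forall u h, u \in V -> h \in X -> 'chi[V]_m (u ^ h)%g = 'chi_m u)%R ->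
    D \subset cfker ('chi_m)%R.
  move=> Xm; rewrite gen_subG; apply/subsetP=> _ /imset2P[e h Ee Xh ->].
  have Ve := subsetP sEV e Ee.
  have Veh: e ^ h \in V by rewrite (subsetP sEV) // memJ_norm ?(subsetP nEX).
  rewrite /= cfkerEirr inE commgEl lin_charM ?groupV // lin_charV // Xm //.
  by rewrite mulVf ?lin_char_neq0 // lin_char1.
have [k def_k] : exists k, ('chi_k = 'chi[V]_i * 'chi_j)%R.
  have /irrP[k Dk] := mul_lin_irr (lin i) (mem_irr j).
  by exists k; rewrite Dk.
have kerDi: D \subset cfker ('chi_i)%R.
  apply: kerD => u h Vu Xh; apply: inertia_valJ.
  by move: h Xh; apply/subsetP; rewrite cycle_subG; case/setIP: Ix.
(* [chi_i] is trivial on [D] and agrees with [chi_k] on [C], so on [V = D * C] it is fixed by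
   whatever fixes [chi_k]. *)
have kJ a u : a \in 'I_A[('chi_k)%R] -> u \in V -> ('chi_i (u ^ a)%g = 'chi_i u)%R.
  move=> /setIP[Aa Ia]; rewrite -{1}defV => /mulsgP[d c Dd Cc ->].
  rewrite conjMg (cfkerMl _ (subsetP kerDi _ (nDA a d Aa Dd))).
  rewrite (cfkerMl _ (subsetP kerDi _ Dd)).
  have := inertia_valJ c Ia; rewrite def_k !cfunE.
  have kj b : b \in C -> ('chi_j b = 1)%R.
    by move/(subsetP kerj); rewrite cfkerEirr inE lin_char1 // => /eqP.
  by rewrite !kj ?nCA // !mulr1.
have sI: 'I_A[('chi_k)%R] \subset 'I_A[('chi_i)%R].
  apply/subsetP=> a Ika; have [Aa _] := setIP Ika.
  have nVa := subsetP nVA a Aa.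
  rewrite inE Aa inE nVa; apply/eqP/cfun_inP=> u Vu.
  by rewrite cfConjgE // kJ ?groupV.
(* Fixing both [chi_k] and [chi_i], [x] would fix their quotient [chi_j], which would then be
   trivial on [D] as well as on [C]. *)
have nxk: x \notin 'I_A[('chi_k)%R].
  apply: contra nz_j => Ikx; rewrite -subGcfker -{1}defV mul_subG //.
  apply: kerD => u h Vu Xh.
  have Ikh: h \in 'I_A[('chi_k)%R] by move: h Xh; apply/subsetP; rewrite cycle_subG.
  have [_ Ih] := setIP Ikh.
  have := inertia_valJ u Ih; rewrite def_k !cfunE kJ //.
  by apply: mulfI; rewrite lin_char_neq0.
have := min_i k isT; rewrite leqNgt => /negP[].
by apply: proper_card; rewrite properE sI; apply/subsetPn; exists x.
Qed.

(** A proper subgroup of a nilpotent group is subnormal, so its normal closure [M] is proper; the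
    nontrivial solvable group [G / M] would then equal its own derived subgroup. *)
Lemma nilpotent_der1_nongen (gT : finGroupType) (G H : {group gT}) :
  nilpotent G -> H \subset G -> G \subset G^`(1) * H -> H :=: G.
Proof.
move=> nilG sHG sGH; have /subnormalEsupport[// | ltMG] := nilpotent_subnormal nilG sHG.
set M := <<_>> in ltMG; have [sMG nMG] := andP ltMG.
have sHM: H \subset M by rewrite sub_gen // sub_class_support.
have nsMG: M <| G by rewrite /normal sMG norms_gen ?class_support_norm.
case/negP: nMG; rewrite -quotient_sub1 ?normal_norm // subG1.
apply: contraLR sGH => ntGM.
have := sol_der1_proper (quotient_sol _ (nilpotent_sol nilG)) (subxx _) ntGM.
rewrite -quotient_der ?normal_norm // => /proper_subn; apply: contra => sGH.
have nMG1 := normal_norm nsMG.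
rewrite quotientSK // -(normC (subset_trans (der_sub 1 G) nMG1)).
by rewrite (subset_trans sGH) ?mulgS.
Qed.

Lemma mem_quotientE (gT : finGroupType) (N K : {group gT}) y :
  N <| K -> y \in 'N(N) -> (coset N y \in K / N) = (y \in K).
Proof.
move=> nsNK Ny; apply/idP/idP=> [KNy |]; last exact: mem_quotient.
by rewrite -(quotientGK nsNK) mem_morphpre.
Qed.

(** [regular_linear_char] and [inertia_vanishing] are applied modulo the derived subgroup of [F].
    Regularity has to be checked: an [r]-element of [A] centralizing the [r']-part [E] of [F] modulo
    that subgroup centralizes [E] itself, and therefore lies in [F]. *)
Lemma Fitting_abelian_vanishing (gT : finGroupType) (G A : {group gT}) x :
    A <| G -> 'F(G) \subset A -> abelian (A / 'F(G)) -> x \in A ->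
  x \notin 'F(G) -> vanishing G x.
Proof.
have [F defF]: exists F : {group gT}, F :=: 'F(G) by exists 'F(G)%G.
have nsFG: F <| G by rewrite defF Fitting_normal.
have nilF: nilpotent F by rewrite defF Fitting_nil.
rewrite -defF => nsAG sFA abAF Ax nFx.
have nsNG: F^`(1) <| G by apply: gFnormal_trans.
have nsNF: F^`(1) <| F := der_normal 1 F.
have nsFA := normalS sFA (normal_sub nsAG) nsFG.
have nsNA: F^`(1) <| A.
  by apply: normalS (normal_sub nsAG) nsNG; apply: subset_trans sFA; apply: der_sub.
have Gx := subsetP (normal_sub nsAG) x Ax.
apply: (vanishing_quotient nsNG Gx) => /=.
have memF y : y \in A -> (coset F^`(1) y \in F / F^`(1)) = (y \in F).
  move=> Ay; rewrite mem_quotientE // (subsetP (normal_norm nsNG)) //.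
  by rewrite (subsetP (normal_sub nsAG)).
have [i sI]: exists i, 'I_(A / F^`(1))[('chi[F / F^`(1)]_i)%R] \subset F / F^`(1).
  apply: regular_linear_char; rewrite ?quotient_normal ?der_abelian //.
    by rewrite (isog_abelian (third_isog _ nsNA nsFA)) ?der_sub.
  move=> r _ pr_r /morphimP[y Ny Ay ->] ry; apply: contra.
  (* Only the image of [y] is known to be an [r]-element; the [r]-part [z] of [y] has the same
     image. *)
  pose z := y.`_r; have Az: z \in A by apply: groupX.
  have Gz := subsetP (normal_sub nsAG) z Az.
  rewrite -(constt_p_elt ry) -morph_constt // memF //.
  pose E := 'O_r^'(F)%G; have nsEG: E <| G by apply: gFnormal_trans.
  have sEF: E \subset F := pcore_sub _ _.
  have nsEF: E <| F by apply: gFnormal.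
  move=> cEz; have sEzN: [~: E, <[z]>] \subset F^`(1).
    rewrite -quotient_cents2 ?cycle_subG; last 2 first.
    - by rewrite (subset_trans sEF) ?gFnorm.
    - by rewrite (subsetP (normal_norm nsNG)).
    rewrite quotient_cycle ?cent_cycle //; last by rewrite (subsetP (normal_norm nsNG)).
    rewrite sub_cent1; apply: subsetP cEz; rewrite centS // pcore_max //.
      by rewrite quotient_pgroup ?pcore_pgroup.
    by rewrite quotient_normal.
  have nEz: <[z]> \subset 'N(E) by rewrite cycle_subG (subsetP (normal_norm nsEG)).
  have coEz: coprime #|E| #|<[z]>|.
    rewrite coprime_sym (pnat_coprime (p_elt_constt _ _)) //; exact: pcore_pgroup.
  have solE: solvable E by apply: solvableS sEF (nilpotent_sol nilF).
  have defE := coprime_cent_prod nEz coEz solE.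
  (* By coprime action ['O_r(F)] and the fixed points of [z] in [E] generate [F] modulo its derived
     subgroup, hence generate [F]. *)
  have cEz': E \subset 'C[z].
    have /dprodP[_ defOE cOE tiOE] := nilpotent_pcoreC r nilF.
    pose H := ('O_r(F) <*> 'C_E(<[z]>))%G.
    have defH: H = 'O_r(F) * 'C_E(<[z]>) :> {set gT}.
      by apply: cent_joinEr; apply: subset_trans (subsetIl _ _) cOE.
    have /eqP: H :=: F.
      apply: nilpotent_der1_nongen => //.
        by rewrite join_subG pcore_sub (subset_trans (subsetIl _ _)).
      rewrite defH mulgA -(normC (subset_trans (pcore_sub r F) (der_norm 1 F))).
      by rewrite -mulgA -{1}defOE mulgS // (subset_trans _ (mulSg _ sEzN)) // defE.
    rewrite eqEsubset => /andP[_ sFH].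
    have: E \subset H by apply: subset_trans sFH.
    rewrite defH => /setIidPl <-; rewrite -group_modr ?subsetIl //.
    by rewrite setIC tiOE mul1g cent_cycle subsetIr.
  (* [R] contains [z], and [R / E] is an [r]-group. The centralizer [C] of [E] in [R] is normal in
     [G], and modulo its center it is an [r]-group; so [C] is nilpotent and lies in ['F(G)]. *)
  pose R := (coset F @*^-1 'O_r(A / F))%G.
  have Rz: z \in R.
    rewrite mem_morphpre ?(subsetP (normal_norm nsFG)) //=.
    rewrite (mem_Hall_pcore (nilpotent_pcore_Hall r (abelian_nil abAF))).
      by rewrite morph_p_elt ?p_elt_constt ?(subsetP (normal_norm nsFG)).
    exact: mem_quotient.
  have nsRG: R <| G.
    rewrite -(quotientGK nsFG) cosetpre_normal.
    by rewrite gFnormal_trans ?quotient_normal.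
  have rRF: r.-group (R / F).
    by rewrite /= cosetpreK pcore_pgroup.
  have sFR: F \subset R by apply: sub_cosetpre.
  have nER: R \subset 'N(E) := subset_trans (normal_sub nsRG) (normal_norm nsEG).
  have nFR: R \subset 'N(F) := subset_trans (normal_sub nsRG) (normal_norm nsFG).
  have rRE: r.-group (R / E).
    rewrite /pgroup card_quotient // -(Lagrange_index sFR sEF) pnatM.
    rewrite -card_quotient // [X in X && _]rRF /=.
    by have /and3P[_ _] := nilpotent_pcore_Hall r^' nilF; rewrite pnatNK.
  pose C := 'C_R(E)%G; have nsCG: C <| G.
    rewrite /normal subIset ?(normal_sub nsRG) //=.
    by rewrite normsI ?norms_cent ?normal_norm.
  suffices nilC: nilpotent C.
    rewrite defF (subsetP (Fitting_max nsCG nilC)) // inE Rz.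
    by apply/centP=> e Ee; apply/esym/cent1P; apply: subsetP cEz' _ _.
  rewrite -quotient_center_nil; apply: (@pgroup_nil _ r).
  have nEC: C \subset 'N(E) := subset_trans (subsetIl _ _) nER.
  have rCE: r.-group (C / E) by apply: pgroupS rRE; rewrite quotientS ?subsetIl.
  rewrite /pgroup card_quotient ?gFnorm //.
  apply: pnat_dvd rCE; rewrite card_quotient // -(indexgI C E) indexgS //.
  by rewrite subsetI subsetIl centsC (subset_trans (subsetIr R 'C(E))) ?centS ?subsetIr.
by apply: (inertia_vanishing _ _ _ sI);
  rewrite ?quotient_normal ?quotientS ?memF ?mem_quotient.
Qed.

(** * Prime power orders and Frobenius groups *)

Lemma pnat_neq (p q n : nat) : p != q -> p.-nat n -> q.-nat n -> n = 1%N.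
Proof.
move=> npq pn qn; apply: (pnat_1 pn); apply: sub_in_pnat qn => r _.
by rewrite !inE => /eqP->; rewrite eq_sym.
Qed.

Lemma p_elt_neq (gT : finGroupType) (p q : nat) (x : gT) :
  p != q -> p.-elt x -> q.-elt x -> x = 1.
Proof. by move=> npq px qx; apply/eqP; rewrite -order_eq1 (pnat_neq npq px qx). Qed.

(** The nontrivial image of [g] determines the prime of which the order of [g] is a power. *)
Lemma p_elt_lift (gT : finGroupType) (N : {group gT}) (s : nat) g :
    prime s -> g \in 'N(N) -> g \notin N -> s.-elt (coset N g) ->
    ppower_elt g -> s.-elt g.
Proof.
move=> pr_s Ng nNg sg [r pr_r rg]; have [<- // | nrs] := eqVneq r s.
case/negP: nNg; rewrite -(ker_coset N); apply/kerP => //.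
by apply: p_elt_neq nrs _ sg; apply: morph_p_elt.
Qed.

(** If [x] in [K] commutes with [g] outside [K], then [x * g] is a [p]-element too, hence so is [x],
    and [x = 1]. *)
Lemma Frobenius_p_elt (gT : finGroupType) (G K : {group gT}) (p : nat) :
    K <| G -> K :!=: 1 -> K \proper G -> p^'.-group K ->
    (forall g, g \in G -> g \notin K -> p.-elt g) ->
  [Frobenius G with kernel K].
Proof.
move=> nsKG ntK ltKG p'K pGK; apply/Frobenius_kerP; split=> // x /setD1P[ntx Kx].
apply/subsetP=> g /setIP[Gg /cent1P cxg]; apply: contraR ntx => nKg.
have pg := pGK g Gg nKg.
have pxg : p.-elt (x * g).
  by apply: pGK; rewrite groupMl // (subsetP (normal_sub nsKG)).
have px: p.-elt x.
  rewrite -(mulgK g x); apply: p_eltM => //; last by rewrite p_eltV.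
  by apply: commuteV; apply: commute_sym; apply: commuteM.
by rewrite -order_eq1 (pnat_1 px (mem_p_elt p'K Kx)).
Qed.

(** The complement acts faithfully and irreducibly on a minimal [H]-invariant subgroup of [K]; an
    abelian group with such a representation is cyclic. *)
Lemma Frobenius_abelian_cyclic (gT : finGroupType) (G K H : {group gT}) :
  [Frobenius G = K ><| H] -> solvable K -> abelian H -> cyclic H.
Proof.
move=> frobG solK abH; have [defG ntK ntH _ _] := Frobenius_context frobG.
have [_ _ nKH _] := sdprodP defG.
have [V minV sVK]: {V : {group gT} | minnormal V H & V \subset K}.
  by apply: mingroup_exists; rewrite ntK.
have [nVH ntV /is_abelemP[p pr_p abelV]] := minnormal_solvable minV sVK solK.
pose rG := abelem_repr abelV ntV nVH.
apply: (mx_faithful_irr_abelian_cyclic (rG := rG)) => //.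
  apply: abelem_mx_faithful; apply/trivgP/subsetP=> h /setIP[Hh cVh].
  apply: contraR (ntV) => nth; rewrite -subG1 -(Frobenius_reg_ker frobG (x := h)).
    by rewrite subsetI sVK sub_cent1.
  by rewrite inE nth.
exact/abelem_mx_irrP.
Qed.

(** Otherwise [H] contains an elementary abelian subgroup of rank two, which is again a Frobenius
    complement but not cyclic. *)
Lemma Frobenius_odd_pgroup_cyclic (gT : finGroupType) (G K H : {group gT}) (q : nat) :
    [Frobenius G = K ><| H] -> solvable K -> q.-group H -> odd #|H| ->
  cyclic H.
Proof.
move=> frobG solK qH oddH; rewrite (odd_pgroup_rank1_cyclic qH oddH) leqNgt.
apply/negP=> /p_rank_geP[E /pnElemP[sEH abelE lE]].
have ntE: E :!=: 1 by apply: contra_eq_neq lE => ->; rewrite cards1 logn1.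
have cycE: cyclic E.
  have frobE := Frobenius_subr ntE sEH frobG.
  exact: Frobenius_abelian_cyclic frobE solK (abelem_abelian abelE).
by rewrite (abelem_cyclic abelE) lE in cycE.
Qed.

Lemma cosetpre_quotient_normal (gT : finGroupType) (G N : {group gT})
    (H : {group coset_of N}) :
  N <| G -> H <| G / N -> coset N @*^-1 H <| G.
Proof. by move=> nsNG nsHG; rewrite -(quotientGK nsNG) cosetpre_normal. Qed.

(** * The second Fitting factor *)

Lemma center_Fitting2_vanishing (gT : finGroupType) (G : {group gT}) g :
    g \in G -> coset 'F(G) g \in 'Z('F(G / 'F(G))) -> g \notin 'F(G) ->
  vanishing G g.
Proof.
move=> Gg Zg nFg; have nFG := normal_norm (Fitting_normal G).
apply: (@Fitting_abelian_vanishing _ _ (coset 'F(G) @*^-1 'Z('F(G / 'F(G))))%G) => //.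
- by rewrite cosetpre_quotient_normal ?gFnormal_trans ?Fitting_normal.
- exact: sub_cosetpre.
- by rewrite /= cosetpreK center_abelian.
by rewrite mem_morphpre // (subsetP nFG).
Qed.

(** Each prime divisor of [#|H|] is the order of a central element, and a product of two such
    elements for distinct primes has no prime power order. *)
Lemma nilpotent_center_ppower (gT : finGroupType) (H : {group gT}) :
    nilpotent H -> H :!=: 1 -> {in 'Z(H), forall z, ppower_elt z} ->
  exists2 s, prime s & s.-group H.
Proof.
move=> nilH ntH ppZ.
have cent_prime r : prime r -> r %| #|H| -> exists2 z, z \in 'Z(H) & #[z] = r.
  move=> pr_r rH.
  have: r \in \pi('Z(H)) by rewrite pi_center_nilpotent // mem_primes pr_r cardG_gt0.
  by rewrite mem_primes => /and3P[_ _ /(Cauchy pr_r)[z]]; exists z.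
have [s pr_s sH] : exists2 s, prime s & s %| #|H|.
  by exists (pdiv #|H|); rewrite ?pdiv_dvd ?pdiv_prime ?cardG_gt1.
exists s => //; apply/pgroupP=> r pr_r rH; apply/eqP.
have [z1 Zz1 oz1] := cent_prime s pr_s sH; have [z2 Zz2 oz2] := cent_prime r pr_r rH.
apply: contraTeq isT => nrs.
have [t pr_t] := ppZ (z1 * z2) (groupM Zz1 Zz2).
have cz: commute z1 z2 by apply: (centsP (center_abelian H)).
have co12: coprime #[z1] #[z2] by rewrite oz1 oz2 prime_coprime // dvdn_prime2 // eq_sym.
rewrite /p_elt orderM // oz1 oz2 pnatM !pnatE // !inE => /andP[/eqP st /eqP rt].
by case/eqP: nrs; rewrite st rt.
Qed.

Lemma Fitting2_pgroup (gT : finGroupType) (G : {group gT}) :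
    ppower_vanishing G -> solvable G -> ~~ nilpotent G ->
  exists s : nat, [/\ prime s, s.-group 'F(G / 'F(G)), 'F(G / 'F(G)) != 1
    & forall g, g \in G -> coset 'F(G) g \in 'Z('F(G / 'F(G))) ->
        g \notin 'F(G) -> s.-elt g].
Proof.
move=> vG solG nnilG; have nsFG := Fitting_normal G.
have nFG := subsetP (normal_norm nsFG).
have ntF2: 'F(G / 'F(G)) != 1.
  rewrite trivg_Fitting ?quotient_sol // -subG1 quotient_sub1 ?normal_norm //.
  by apply: contra nnilG => sGF; apply: nilpotentS sGF (Fitting_nil G).
have vanF2 g : g \in G -> coset 'F(G) g \in 'Z('F(G / 'F(G))) -> g \notin 'F(G) ->
    ppower_elt g.
  by move=> Gg Zg nFg; apply: vG => //; apply: center_Fitting2_vanishing.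
have [|s pr_s sF2] := nilpotent_center_ppower (Fitting_nil _) ntF2.
  move=> z Zz; have /morphimP[g Ng Gg Dz] : z \in G / 'F(G).
    by rewrite (subsetP (Fitting_sub _)) // (subsetP (center_sub _)).
  have [Fg|nFg] := boolP (g \in 'F(G)).
    by exists 2; rewrite ?Dz /= ?coset_id ?p_elt1.
  case: (vanF2 g) => [//||//|r pr_r rg]; first by rewrite -Dz.
  by exists r; rewrite ?Dz ?morph_p_elt.
exists s; split=> // g Gg Zg nFg; apply: (@p_elt_lift _ 'F(G)) (vanF2 g Gg Zg nFg) => //.
  exact: nFG.
by apply: mem_p_elt sF2 _; apply: subsetP Zg; apply: center_sub.
Qed.

(** * Nilpotent [G / 'F(G)] *)

(** Here [G / 'F(G)] is its own Fitting subgroup: its central elements lift to zeros by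
    [center_Fitting2_vanishing], the others by [nilpotent_vanishing]. *)
Lemma Fitting_quotient_nil (gT : finGroupType) (G : {group gT}) :
    ppower_vanishing G -> solvable G -> ~~ nilpotent G ->
    nilpotent (G / 'F(G)) ->
  exists p : nat, [/\ prime p, p.-group (G / 'F(G)),
      forall g, g \in G -> g \notin 'F(G) -> vanishing G g
    & forall g, g \in G -> g \notin 'F(G) -> p.-elt g].
Proof.
move=> vG solG nnilG nilGF; have nFG := subsetP (normal_norm (Fitting_normal G)).
have [p [pr_p + _ Fp]] := Fitting2_pgroup vG solG nnilG.
rewrite (nilpotent_Fitting nilGF) => pGF.
have vanGF g : g \in G -> g \notin 'F(G) -> vanishing G g.
  move=> Gg nFg; have GFg : coset 'F(G) g \in G / 'F(G) by apply: mem_quotient.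
  have [Zg|nZg] := boolP (coset 'F(G) g \in 'Z(G / 'F(G))).
    by apply: center_Fitting2_vanishing; rewrite ?(nilpotent_Fitting nilGF).
  apply: vanishing_quotient (Fitting_normal G) Gg _.
  exact: nilpotent_vanishing.
exists p; split=> // g Gg nFg; apply: (@p_elt_lift _ 'F(G)) => //.
- exact: nFG.
- exact: mem_p_elt pGF (mem_quotient _ Gg).
by apply: vG => //; apply: vanGF.
Qed.

Lemma Frobenius_p_elt_quotient (gT : finGroupType) (G K N : {group gT}) (p : nat) :
    K <| G -> N <| G -> N \proper K -> K \proper G -> p^'.-group (K / N) ->
    (forall g, g \in G -> g \notin K -> p.-elt g) ->
  [Frobenius G / N with kernel K / N].
Proof.
move=> nsKG nsNG ltNK ltKG p'KN pGK; have [sNK _] := andP ltNK.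
have nsNK := normalS sNK (normal_sub nsKG) nsNG.
apply: (@Frobenius_p_elt _ _ _ p) => //.
- exact: quotient_normal.
- by rewrite -subG1 quotient_sub1 ?normal_norm //; apply: proper_subn.
- by rewrite quotient_proper.
move=> _ /morphimP[g Ng Gg ->]; rewrite mem_quotientE // => nKg.
by apply: morph_p_elt => //; apply: pGK.
Qed.

(** If the [p']-part [y] of a central element lies in [K], then [g] and [g * y] are commuting
    [p]-elements for [g] outside [K]; in all cases [y] is a [p]-element, so [y = 1]. *)
Lemma center_sub_pcore (gT : finGroupType) (G K : {group gT}) (p : nat) :
    K \proper G -> (forall g, g \in G -> g \notin K -> p.-elt g) ->
  'Z(G) \subset 'O_p(G).
Proof.
move=> /properP[sKG [g Gg nKg]] pGK; apply/subsetP=> z Zz.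
have [Gz _] := setIP Zz; set y := z.`_p^'.
have Zy: y \in 'Z(G) by apply: groupX.
have [Gy cGy] := setIP Zy.
have y1: y = 1.
  have py: p.-elt y.
    have [Ky|] := boolP (y \in K); last exact: pGK.
    rewrite -(mulKg g y); apply: p_eltM.
    - by apply: commuteM; rewrite /commute ?mulVg ?mulgV // -(centP cGy) ?groupV.
    - by rewrite p_eltV pGK.
    by apply: pGK; [apply: groupM | rewrite groupMr].
  by apply/eqP; rewrite -order_eq1; apply/eqP/(pnat_1 py (p_elt_constt _ _)).
have pz: p.-elt z by rewrite -(consttC p z) -/y y1 mulg1 p_elt_constt.
rewrite -cycle_subG pcore_max // sub_center_normal //.
by rewrite cycle_subG.
Qed.

(** ['O_p(G)] centralizes [E]. If its element [u] were not central modulo [E], then for [e != 1] in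
    [E] the zero [u * e] would be a [p]-element, and so would [e]. Hence the commutators of [u] lie
    in [E] and in ['O_p(G)], which meet trivially. *)
Lemma pcore_sub_center (gT : finGroupType) (G E : {group gT}) (p : nat) :
    prime p -> ppower_vanishing G -> E <| G -> E :!=: 1 -> p^'.-group E ->
    p.-group (G / E) ->
  'O_p(G) \subset 'Z(G).
Proof.
move=> pr_p vG nsEG ntE p'E pGE; have nEG := subsetP (normal_norm nsEG).
have [e Ee nte] := trivgPn _ ntE; have sEG := subsetP (normal_sub nsEG).
have tiUE: 'O_p(G) :&: E = 1 by apply: coprime_TIg (pnat_coprime (pcore_pgroup _ _) p'E).
have cUE: E \subset 'C('O_p(G)).
  rewrite (sameP commG1P trivgP) /= -tiUE setIC commg_subI //.
    by rewrite subsetI subxx (subset_trans (normal_sub nsEG)) ?gFnorm.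
  by rewrite subsetI subxx (subset_trans (pcore_sub _ _)) ?normal_norm.
apply/subsetP=> u Uu; have Gu := subsetP (pcore_sub _ _) u Uu.
have pu: p.-elt u := mem_p_elt (pcore_pgroup _ _) Uu.
have [Eu|nEu] := boolP (u \in E).
  suffices ->: u = 1 by apply: group1.
  by apply/set1P; rewrite -[[set 1]]tiUE inE Uu.
have Zu: coset E u \in 'Z(G / E).
  apply: contraR nte => nZu; have cue := centsP cUE e Ee u Uu.
  have Eue: coset E (u * e) = coset E u.
    by rewrite morphM ?nEG ?(sEG e) //= (coset_id Ee) mulg1.
  have Gue: u * e \in G by rewrite groupM ?(sEG e).
  have pue: p.-elt (u * e).
    apply: (@p_elt_lift _ E) => //; first exact: nEG.
    - by rewrite groupMr.
    - by rewrite Eue morph_p_elt ?nEG.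
    apply: vG => //; apply: vanishing_quotient nsEG Gue _.
    by rewrite Eue; apply: nilpotent_vanishing; rewrite ?mem_quotient ?(pgroup_nil pGE).
  have pe: p.-elt e.
    rewrite -(mulKg u e); apply: p_eltM => //; last by rewrite p_eltV.
    by apply: commute_sym; apply: commuteV; apply: commute_sym; apply: commuteM.
  by rewrite -order_eq1 (pnat_1 pe (mem_p_elt p'E Ee)).
rewrite inE Gu; apply/centP=> g Gg; apply/commgP.
rewrite -in_set1 -[[set 1]]tiUE inE; apply/andP; split.
  by rewrite groupMl ?groupV // memJ_norm // (subsetP (gFnorm _ _)).
rewrite coset_idr ?groupR ?nEG // morphR ?nEG //=; apply/eqP/commgP.
by have [_ cZ] := setIP Zu; apply: (centP cZ); apply: mem_quotient.
Qed.

(** * Fixed-point-free action of a Frobenius group *)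

Section FrobeniusModule.

Import FiniteModule.

(* The Frobenius partition of [H] writes the sum over [H] as the sum over [K]
   plus sums over the conjugates of [Y]; since each of those subgroups has no
   fixed point on [V], all these sums kill [V], and only copies of the identity
   remain: a divisor of [#|K|] annihilates [V]. *)
Lemma Frobenius_regular_trivial (gT : finGroupType) (G F V : {group gT})
    (H K Y : {group coset_of F}) :
    F <| G -> G \subset 'N(V) -> abelian V -> F \subset 'C(V) ->
    H \subset G / F -> [Frobenius H = K ><| Y] -> coprime #|V| #|K| ->
    (forall g, g \in G -> coset F g \in H -> g \notin F -> 'C_V[g] = 1) ->
  V :=: 1.
Proof.
move=> nsFG nVG abV cVF sHG frobH coVK regV; apply/trivgP/subsetP=> v Vv.
have [/sdprodP[_ defH nKY tiKY] ntK ntY _ _] := Frobenius_context frobH.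
have [sKH sYH]: K \subset H /\ Y \subset H by apply/andP; rewrite -mulG_subG defH.
pose u : fmod_of abV := fmod abV v.
(* [H] acts through coset representatives; [actM] holds because [F] centralizes [V]. *)
pose act (h : coset_of F) : fmod_of abV := (u ^@ repr h)%R.
have reprG h : h \in H -> repr h \in G.
  move/(subsetP sHG); rewrite -{1}[h]coset_reprK mem_quotientE //.
  exact: repr_coset_norm.
have nVr h : h \in H -> repr h \in 'N(V) by move/reprG/(subsetP nVG).
have actM h k : h \in H -> k \in H -> (act h ^@ repr k)%R = act (h * k).
  move=> Hh Hk; rewrite /act -actrM ?nVr //.
  pose hk : coset_of F := h * k.
  have /rcosetP[f Ff ->]: repr h * repr k \in F :* repr hk.
    apply/rcoset_kercosetP; rewrite ?groupM ?repr_coset_norm //.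
    have -> := morphM (coset_morphism F) (repr_coset_norm h) (repr_coset_norm k).
    rewrite coset_reprK; congr (_ * _); exact: coset_reprK.
  have cVf := subsetP cVF f Ff.
  have nVf: f \in 'N(V) by apply: subsetP cVf; apply: cent_sub.
  rewrite actrM ?nVr ?groupM //; congr (_ ^@ _)%R; apply: val_inj.
  by rewrite fmvalJ // /conjg -(centP cVf _ (fmodP u)) mulKg.
(* The sum over [T] is fixed by a nontrivial [t] in [T], whose representative has no nontrivial
   fixed point on [V]. *)
have S0 (T : {group coset_of F}) : T \subset H -> T :!=: 1 -> (\sum_(h in T) act h = 0)%R.
  move=> sTH /trivgPn[t Tt ntt]; have Ht := subsetP sTH t Tt.
  set w := (\sum_(h in T) _)%R.
  have wt: (w ^@ repr t)%R = w.
    rewrite /w (big_morph (actr^~ (repr t)) (actAr _) (act0r _ _)).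
    rewrite [RHS](reindex_inj (mulIg t)) /=; apply: eq_big => h; first by rewrite groupMr.
    by move/(subsetP sTH) => Hh; apply: actM.
  apply: val_inj => /=; apply/set1P.
  rewrite -[[set _]](regV (repr t)) ?reprG ?coset_reprK //.
    rewrite inE fmodP; apply/cent1P; rewrite /commute [LHS]conjgC.
    by rewrite -fmvalJ ?nVr // wt.
  by apply: contra ntt => /coset_id; rewrite coset_reprK => ->.
have: (\sum_(h in H) act h = 0)%R by apply: S0; rewrite ?(subG1_contra sKH).
rewrite (set_partition_big _ (Frobenius_partition frobH)) /=.
rewrite big_setU1 /=; last first.
  apply/imsetP=> [[k _ /setP/(_ 1)]]; rewrite group1 conjD1g !inE eqxx //.
rewrite S0 // add0r.
rewrite (eq_bigr (fun=> - u)%R) => [|_ /imsetP[k Kk ->]]; last first.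
  have sYkH: Y :^ k \subset H by rewrite conj_subG ?(subsetP sKH).
  apply: (addrI (act 1)); rewrite conjD1g -big_setD1 ?group1 //.
  rewrite (S0 (Y :^ k)%G) //; first by rewrite /act repr_coset1 actr1 addrN.
  by rewrite -!cardG_gt1 cardJg in ntY *.
rewrite sumr_const mulNrn => /eqP; rewrite oppr_eq0 => /eqP/(congr1 val)/=.
rewrite fmvalZ fmodK // fmval0 => /eqP; rewrite -order_dvdn card_conjugates => vn.
apply/set1P/eqP; rewrite -order_eq1 -dvdn1 -(eqP coVK) dvdn_gcd order_dvdG //.
exact: dvdn_trans vn (dvdn_indexg _ _).
Qed.

End FrobeniusModule.

(** * Primes of successive Fitting factors *)

Lemma Fitting2_trivg (gT : finGroupType) (G : {group gT}) (s : nat) :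
  s.-group 'F(G) -> s.-group 'F(G / 'F(G)) -> 'F(G / 'F(G)) = 1.
Proof.
move=> sF sF2; have nsFG := Fitting_normal G.
pose B := (coset 'F(G) @*^-1 'F(G / 'F(G)))%G.
have nsBG: B <| G by rewrite cosetpre_quotient_normal ?Fitting_normal.
have defF2: B / 'F(G) = 'F(G / 'F(G)) by rewrite /= cosetpreK.
have sB: s.-group B.
  rewrite -(pquotient_pgroup sF) ?defF2 //.
  exact: subset_trans (normal_sub nsBG) (normal_norm nsFG).
by rewrite -defF2 quotientS1 // Fitting_max ?(pgroup_nil sB).
Qed.

(** Realizes [T] as a Frobenius complement: modulo [W], the [s]-part of ['F(G)], the preimage of [T]
    has the [s']-group ['F(G) / W] as Frobenius kernel. This kernel is nontrivial by
    [Fitting2_trivg]. *)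
Lemma Fitting2_Frobenius (gT : finGroupType) (G : {group gT}) (s : nat)
    (T : {group coset_of 'F(G)}) :
    s.-group 'F(G / 'F(G)) -> T <| G / 'F(G) -> nilpotent T -> T :!=: 1 ->
    (forall g, g \in G -> coset 'F(G) g \in T -> g \notin 'F(G) -> s.-elt g) ->
  exists (rT : finGroupType) (B K H : {group rT}),
    [/\ [Frobenius B = K ><| H], solvable K & H \isog T].
Proof.
move=> sF2 nsTG nilT ntT Ts; have nsFG := Fitting_normal G.
pose A := (coset 'F(G) @*^-1 T)%G.
have nsAG: A <| G by rewrite cosetpre_quotient_normal.
have sAG := normal_sub nsAG.
have nFA: A \subset 'N('F(G)) := subset_trans sAG (normal_norm nsFG).
have sFA: 'F(G) \subset A by apply: sub_cosetpre.
have nsFA: 'F(G) <| A by apply/andP.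
have defAF: A / 'F(G) = T by rewrite /= cosetpreK.
pose W := 'O_s('F(G))%G.
have nsWG: W <| G by rewrite gFnormal_trans.
have nsWA: W <| A by apply: normalS sAG nsWG; apply: subset_trans (pcore_sub _ _) sFA.
have ltWF: W \proper 'F(G).
  rewrite properEneq pcore_sub andbT; apply: contraNneq ntT => defW.
  rewrite -subG1 -(@Fitting2_trivg _ G s) //; first by rewrite Fitting_max.
  by rewrite -defW pcore_pgroup.
have ltFA: 'F(G) \proper A.
  by rewrite properE sFA -quotient_sub1 // defAF subG1.
have s'FW: s^'.-group ('F(G) / W).
  rewrite /pgroup card_quotient ?gFnorm //.
  by have /and3P[] := nilpotent_pcore_Hall s (Fitting_nil G).
have /existsP[H frobA]: [Frobenius A / W with kernel 'F(G) / W].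
  apply: (@Frobenius_p_elt_quotient _ _ _ _ s) => // g Ag nFg.
  apply: Ts => //; first exact: subsetP Ag.
  by rewrite -defAF mem_quotient.
exists (coset_of W), (A / W)%G, ('F(G) / W)%G, H; split=> //.
  by rewrite quotient_sol // nilpotent_sol ?Fitting_nil.
have [defA _ _ _ _] := Frobenius_context frobA.
apply: isog_trans (sdprod_isog defA) _.
have isoAF := third_isog (proper_sub ltWF) nsWA nsFA.
by apply: isog_trans isoAF _; rewrite /= cosetpreK isog_refl.
Qed.

Lemma center_Fitting2_cyclic (gT : finGroupType) (G : {group gT}) (s : nat) :
    s.-group 'F(G / 'F(G)) -> 'F(G / 'F(G)) != 1 ->
    (forall g, g \in G -> coset 'F(G) g \in 'Z('F(G / 'F(G))) ->
        g \notin 'F(G) -> s.-elt g) ->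
  cyclic 'Z('F(G / 'F(G))).
Proof.
move=> sF2 ntF2 Fs; have abZ := center_abelian 'F(G / 'F(G)).
have [] := @Fitting2_Frobenius _ G s 'Z('F(G / 'F(G)))%G sF2 _ (abelian_nil abZ) _ Fs.
- by rewrite gFnormal_trans ?Fitting_normal.
- by rewrite /= center_nil_eq1 ?Fitting_nil.
move=> rT [B [K [H [frobB solK isoH]]]].
rewrite -(isog_cyclic isoH); apply: Frobenius_abelian_cyclic frobB solK _.
by rewrite (isog_abelian isoH).
Qed.

Lemma Fitting_height3 (gT : finGroupType) (G : {group gT}) :
    ppower_vanishing G -> solvable G -> ~~ nilpotent (G / 'F(G)) ->
  exists s u : nat, [/\ [/\ prime s, prime u & u < s], s.-group 'F(G / 'F(G)),
      u.-group 'F(G / 'F(G) / 'F(G / 'F(G)))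
    & forall r, prime r -> r %| #|'F(G)| -> (r == s) || (r == u)].
Proof.
move=> vG solG nnilGF; have nsFG := Fitting_normal G.
have nFG := subsetP (normal_norm nsFG).
have nnilG: ~~ nilpotent G by apply: contra nnilGF; apply: quotient_nil.
have [s [pr_s sF2 ntF2 Fs]] := Fitting2_pgroup vG solG nnilG.
pose G1 := (G / 'F(G))%G; pose S := 'F(G1)%G.
have vG1: ppower_vanishing G1 by apply: ppower_vanishing_quotient.
have solG1: solvable G1 by apply: quotient_sol.
have nsSG1: S <| G1 := Fitting_normal G1; have nSG1 := subsetP (normal_norm nsSG1).
have [u [pr_u uF3 ntF3 Su]] := Fitting2_pgroup vG1 solG1 nnilGF.
have nsu: s != u.
  by apply: contraNneq ntF3 => su; apply/eqP/(@Fitting2_trivg _ _ u); rewrite // -su.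
have Gu g : g \in G -> coset S (coset 'F(G) g) \in 'Z('F(G1 / S)) ->
    coset 'F(G) g \notin S -> u.-elt g.
  move=> Gg Zg nSg; have G1g: coset 'F(G) g \in G1 by apply: mem_quotient.
  apply: (@p_elt_lift _ 'F(G)) => //; first exact: nFG.
  - by apply: contra nSg => /coset_id->; apply: group1.
  - exact: Su.
  apply: vG => //; apply: vanishing_quotient nsFG Gg _.
  exact: center_Fitting2_vanishing.
have cycZ: cyclic 'Z(S) by apply: center_Fitting2_cyclic sF2 ntF2 Fs.
have sZ: s.-group 'Z(S) := pgroupS (center_sub S) sF2.
have ntZ: 'Z(S) != 1 by rewrite center_nil_eq1 ?Fitting_nil.
(* The Frobenius group of order [s * u] is built from [K], of order [s] since ['Z(S)] is a
   nontrivial cyclic [s]-group, and a cyclic group of order [u]. *)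
pose K := 'Ohm_1('Z(S))%G.
have oK: #|K| = s by apply: Ohm1_cyclic_pgroup_prime.
have sKS: K \subset S := subset_trans (Ohm_sub _ _) (center_sub _).
have nsKG1: K <| G1.
  by apply: gFnormal_trans; apply: gFnormal_trans.
(* Lift an element of order [u] from the center of the next Fitting factor. The lift [y] is a
   [u]-element and [y ^+ u] lies in the [s]-group [S], so [y] has order exactly [u]. *)
have [y G1y [nSy Zy oy]]: exists2 y, y \in G1
    & [/\ y \notin S, coset S y \in 'Z('F(G1 / S)) & #[y] = u].
  have uZ: u.-group 'Z('F(G1 / S)) := pgroupS (center_sub _) uF3.
  have ntZ3: 'Z('F(G1 / S)) != 1 by rewrite center_nil_eq1 ?Fitting_nil.
  have [_ uZ3 _] := pgroup_pdiv uZ ntZ3.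
  have [y0 Zy0 oy0] := Cauchy pr_u uZ3.
  have : y0 \in G1 / S.
    by rewrite (subsetP (Fitting_sub _)) // (subsetP (center_sub _)).
  case/morphimP=> y Ny G1y Dy.
  have nSy: y \notin S.
    apply: contraTN pr_u => /coset_id y1.
    by rewrite -oy0 Dy /= y1 order1.
  have Zy: coset S y \in 'Z('F(G1 / S)) by rewrite -[coset S y]Dy.
  exists y => //; split=> //.
  have uy: u.-elt y by apply: Su.
  have yu1: y ^+ u = 1.
    apply: p_elt_neq nsu _ (p_eltX _ uy); apply: mem_p_elt sF2 _.
    apply: coset_idr; first by rewrite groupX.
    by rewrite morphX //= -[coset S y]Dy -oy0 expg_order.
  apply: nt_prime_order => //; by apply: contraNneq nSy => ->; apply: group1.
pose Y := <[y]>%G.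
have nKY: Y \subset 'N(K) by rewrite cycle_subG (subsetP (normal_norm nsKG1)).
have coKY: coprime #|K| #|Y|.
  by rewrite oK /= -orderE oy prime_coprime // dvdn_prime2.
pose H := (K <*> Y)%G.
have defH: K ><| Y = H by rewrite /= norm_joinEr // sdprodE // coprime_TIg.
have [nsKH _ _ _ _] := sdprod_context defH.
have sHG1: H \subset G1 by rewrite join_subG (normal_sub nsKG1) cycle_subG.
have Hu h : h \in H -> h \notin K -> coset S h \in 'Z('F(G1 / S)) /\ h \notin S.
  rewrite /= norm_joinEr // => /mulsgP[k _ Kk /cycleP[i ->] ->] nKh.
  have Sk := subsetP sKS k Kk.
  have Ny: y \in 'N(S) by apply: nSG1.
  split; last first.
    rewrite groupMl //; apply: contra nKh => Syi.
    suffices ->: y ^+ i = 1 by rewrite mulg1.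
    apply: p_elt_neq nsu (mem_p_elt sF2 Syi) (p_eltX _ _).
    by rewrite /p_elt oy pnat_id.
  have Nk: k \in 'N(S) by apply: subsetP Sk; apply: normG.
  rewrite morphM ?groupX //= (coset_id Sk) mul1g.
  by rewrite morphX //= groupX.
have ntK: K :!=: 1 by rewrite -cardG_gt1 oK prime_gt1.
have frobH: [Frobenius H = K ><| Y].
  apply: set_Frobenius_compl defH _; apply: (@Frobenius_p_elt _ _ _ u) => //.
  - rewrite properE (normal_sub nsKH); apply/subsetPn; exists y.
      by rewrite (subsetP (joing_subr _ _)) ?cycle_id.
    by apply: contra nSy; apply: subsetP.
  - by rewrite /pgroup oK p'natE // dvdn_prime2 // eq_sym.
  move=> h Hh nKh; have [Zh nSh] := Hu h Hh nKh.
  by apply: Su => //; apply: subsetP Hh.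
have ltus: u < s.
  have:= Frobenius_dvd_ker1 frobH; rewrite oK /= -orderE oy => /dvdn_leq.
  by rewrite -(prednK (prime_gt0 pr_s)) ltnS; apply; rewrite -subn1 subn_gt0 prime_gt1.
exists s, u; split=> // r pr_r rF; apply: contraT; rewrite negb_or => /andP[nrs nru].
(* The center of the [r]-part is centralized by all of ['F(G)], so [G / 'F(G)] acts on it. *)
pose R := 'O_r('F(G))%G; pose V := 'Z(R)%G.
have rR: r.-group R := pcore_pgroup _ _.
have nsVG: V <| G by apply: gFnormal_trans; apply: gFnormal_trans.
have sVF: V \subset 'F(G) := subset_trans (center_sub _) (pcore_sub _ _).
have rV: r.-group V := pgroupS (center_sub _) rR.
have ntV: V :!=: 1.
  rewrite center_nil_eq1 ?(pgroup_nil rR) // -cardG_gt1.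
  have := card_Hall (nilpotent_pcore_Hall r (Fitting_nil G)).
  by move=> ->; rewrite p_part_gt1 mem_primes pr_r rF cardG_gt0.
case/eqP: ntV; apply: (Frobenius_regular_trivial nsFG _ _ _ sHG1 frobH) => //.
- exact: normal_norm.
- exact: center_abelian.
- have /dprodP[_ defF cRR' _] := nilpotent_pcoreC r (Fitting_nil G).
  rewrite -{1}defF mul_subG //; first by rewrite centsC subsetIr.
  by rewrite (subset_trans cRR') // centS ?center_sub.
- rewrite oK; apply: pnat_coprime rV _.
  by rewrite p'natE // dvdn_prime2.
(* [g] and [g * v] have the same coset, so both are [t]-elements for the same [t], either [s] or
   [u]; as they commute, the [r]-element [v] is a [t]-element as well. *)
move=> g Gg Hg nFg; apply/trivgP/subsetP=> v /setIP[Vv /cent1P cgv].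
have rv: r.-elt v := mem_p_elt rV Vv; have Fv := subsetP sVF v Vv.
have Ecgv: coset 'F(G) (g * v) = coset 'F(G) g.
  have Nv: v \in 'N('F(G)) by apply: subsetP Fv; apply: normG.
  by rewrite morphM ?(nFG g) //= [X in _ * X]coset_id ?mulg1.
have Ggv: g * v \in G.
  by rewrite groupM //; apply: subsetP Vv; apply: normal_sub.
apply/set1P.
have elt_v (t : nat) : r != t -> t.-elt g -> t.-elt (g * v) -> v = 1.
  move=> nrt tg tgv; apply: p_elt_neq nrt rv _.
  rewrite -(mulKg g v); apply: p_eltM => //; last by rewrite p_eltV.
  by apply: commute_sym; apply: commuteV; apply: commute_sym; apply: commuteM.
have [Kg | nKg] := boolP (coset 'F(G) g \in K).
  have Zg: coset 'F(G) g \in 'Z(S) by apply: subsetP Kg; apply: Ohm_sub.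
  apply: (elt_v s) => //; apply: Fs; rewrite ?Ecgv //.
  by rewrite groupMr.
have [Zg nSg] := Hu _ Hg nKg.
by apply: (elt_v u) => //; apply: Gu; rewrite ?Ecgv.
Qed.

(** * Commutativity of the second Fitting factor *)

Lemma der1_cent_cyclic (gT : finGroupType) (G T : {group gT}) :
  T <| G -> cyclic T -> G^`(1) \subset 'C(T).
Proof.
move=> /andP[_ nTG] cycT; rewrite -ker_conj_aut ker_trivg_morphim.
have sG'N: G^`(1) \subset 'N(T) := subset_trans (der_sub 1 G) nTG.
rewrite sG'N morphim_der //= (derG1P _) //.
exact: abelianS (Aut_conj_aut T G) (Aut_cyclic_abelian cycT).
Qed.

Lemma Frobenius_ker_sub_der1 (gT : finGroupType) (G K H : {group gT}) :
  [Frobenius G = K ><| H] -> solvable K -> K \subset G^`(1).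
Proof.
move=> frobG solK; have [defG _ _ _ _] := Frobenius_context frobG.
have [_ sHG _ nKH _] := sdprod_context defG.
have [/andP[sKG _] _ _ _ _] := sdprod_context defG.
rewrite -{1}(coprime_cent_prod nKH (Frobenius_coprime frobG) solK).
by rewrite (Frobenius_trivg_cent frobG) mulg1 commgSS.
Qed.

(** The second center [T] of [S] also lifts to [q]-elements outside ['F(G)], so [T] is a Frobenius
    complement, cyclic as [q] is odd. The Frobenius kernel [S] lies in the derived subgroup of [G1],
    hence centralizes [T]; so the upper central series of [S] stops at ['Z(S)]. *)
Lemma Fitting2_abelian (gT : finGroupType) (G : {group gT}) (q : nat) :
    ppower_vanishing G -> prime q -> odd q -> q.-group 'F(G / 'F(G)) ->
    [Frobenius G / 'F(G) with kernel 'F(G / 'F(G))] ->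
    (forall g, g \in G -> coset 'F(G) g \in 'Z('F(G / 'F(G))) ->
        g \notin 'F(G) -> q.-elt g) ->
  abelian 'F(G / 'F(G)).
Proof.
move=> vG pr_q odd_q qF2 frobGF Fq; have nsFG := Fitting_normal G.
have nFG := subsetP (normal_norm nsFG).
pose G1 := (G / 'F(G))%G; pose S := 'F(G1)%G.
have [ntS _ nsSG1 _] := Frobenius_kerP frobGF.
have cycZ: cyclic 'Z(S) by apply: center_Fitting2_cyclic qF2 ntS Fq.
have nsZG1: 'Z(S) <| G1 by apply: gFnormal_trans.
pose T := 'Z_2(S)%G.
have nsTG1: T <| G1 by apply: gFnormal_trans.
have sTS: T \subset S := ucn_sub 2 S.
have qT: q.-group T := pgroupS sTS qF2.
have Tq g : g \in G -> coset 'F(G) g \in T -> g \notin 'F(G) -> q.-elt g.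
  move=> Gg Tg nFg; have [Zg | nZg] := boolP (coset 'F(G) g \in 'Z(S)); first exact: Fq.
  apply: (@p_elt_lift _ 'F(G)) => //; [exact: nFG | exact: mem_p_elt qT Tg |].
  apply: vG => //; apply: vanishing_quotient nsFG Gg _.
  have Sg := subsetP sTS _ Tg.
  have /subsetPn[k Sk ncgk]: ~~ (S \subset 'C[coset 'F(G) g]).
    by apply: contra nZg => cSg; rewrite inE Sg /= -sub_cent1.
  have Zgk: [~ coset 'F(G) g, k] \in 'Z(S).
    by rewrite -ucn1; apply: subsetP (ucn_comm 1 S) _ (mem_commg Tg Sk).
  apply: (commutator_vanishing nsSG1 Sg Sk Zgk).
    by apply: contra ncgk => /commgP cgk; apply/cent1P.
  (* Subgroups of the cyclic center are characteristic in it, hence normal in [G1]. *)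
  by apply: char_normal_trans nsZG1; rewrite sub_cyclic_char // cycle_subG.
have ntT: T :!=: 1.
  apply: contraNneq ntS => T1; rewrite -(center_nil_eq1 (Fitting_nil _)) -ucn1 -subG1.
  by rewrite -T1 ucn_subS.
have cycT: cyclic T.
  have [rT [B [K [H [frobB solK isoH]]]]] :=
    Fitting2_Frobenius qF2 nsTG1 (pgroup_nil qT) ntT Tq.
  rewrite -(isog_cyclic isoH); apply: Frobenius_odd_pgroup_cyclic frobB solK _ _.
    by rewrite /pgroup (card_isog isoH); apply: qT.
  by rewrite (card_isog isoH) (card_pgroup qT) oddX odd_q orbT.
have sTZ: T \subset 'Z(S).
  rewrite subsetI sTS centsC; apply: subset_trans (der1_cent_cyclic nsTG1 cycT).
  have /existsP[P frobP] := frobGF.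
  by apply: Frobenius_ker_sub_der1 frobP _; apply: nilpotent_sol (Fitting_nil _).
have: 'Z(S / 'Z_1(S)) == 1.
  rewrite -ucn_central; apply/eqP/trivgP.
  rewrite quotient_sub1; first by rewrite /= ucn1.
  by rewrite (subset_trans sTS) ?gFnorm.
rewrite center_nil_eq1 ?quotient_nil ?Fitting_nil // -subG1 quotient_sub1 ?gFnorm //.
by rewrite /= ucn1 => /abelianS; apply; apply: center_abelian.
Qed.

(** * The cases of the classification *)

(** For [x] not central and [z] central, [x] and [x * z] are zeros with the same image modulo the
    center, so both are [p]-elements for one [p], and so is [z]. *)
Lemma nilpotent_ppower_vanishing (gT : finGroupType) (G : {group gT}) :
    ppower_vanishing G -> nilpotent G -> ~~ abelian G ->
  exists2 p : nat, prime p & p.-group G.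
Proof.
move=> vG nilG nabG.
have ntG: G :!=: 1 by apply: contraNneq nabG => ->; apply: abelian1.
have [x Gx nZx] : exists2 x, x \in G & x \notin 'Z(G).
  apply/subsetPn; apply: contra nabG => sGZ; exact: abelianS sGZ (center_abelian G).
have nZG := subsetP (normal_norm (center_normal G)).
have [p pr_p px] := vG x Gx (nilpotent_vanishing nilG Gx nZx).
apply: nilpotent_center_ppower => // z Zz; exists p => //.
have [Gz cGz] := setIP Zz.
have pxz: p.-elt (x * z).
  have nZxz: x * z \notin 'Z(G) by rewrite groupMr.
  apply: (@p_elt_lift _ 'Z(G)) => //.
  - by rewrite nZG ?groupM.
  - by rewrite morphM ?nZG //= [X in _ * X]coset_id // mulg1 morph_p_elt ?nZG.
  have Gxz : x * z \in G by apply: groupM.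
  exact: vG Gxz (nilpotent_vanishing nilG Gxz nZxz).
rewrite -(mulKg x z); apply: p_eltM => //; last by rewrite p_eltV.
have cxz: commute x z by apply/esym/(centP cGz).
by apply: commute_sym; apply: commuteV; apply: commute_sym; apply: commuteM.
Qed.

Lemma Fitting_quotient_nil_Frobenius (gT : finGroupType) (G : {group gT}) :
    ppower_vanishing G -> solvable G -> ~~ nilpotent G ->
    nilpotent (G / 'F(G)) ->
  exists2 p : nat, prime p &
    (exists2 H : {group coset_of 'Z(G)},
       [Frobenius G / 'Z(G) with complement H] & p.-group H)
    /\ 'Z(G) = 'O_p(G).
Proof.
move=> vG solG nnilG nilGF; have nsFG := Fitting_normal G.
have [p [pr_p pGF _ pGnF]] := Fitting_quotient_nil vG solG nnilG nilGF.
have ltFG: 'F(G) \proper G.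
  rewrite properE Fitting_sub; apply: contra nnilG => sGF.
  exact: nilpotentS sGF (Fitting_nil G).
have n_pG: ~~ p.-group G by apply: contra nnilG; apply: pgroup_nil.
have n_pF: ~~ p.-group 'F(G).
  by apply: contra n_pG => pF; rewrite -(pquotient_pgroup pF) ?normal_norm.
pose E := 'O_p^'('F(G))%G.
have hallE := nilpotent_pcore_Hall p^' (Fitting_nil G).
have sEF: E \subset 'F(G) := pcore_sub _ _.
have nsEG: E <| G by rewrite gFnormal_trans.
have p'E: p^'.-group E := pcore_pgroup _ _.
have pFE: p.-nat #|'F(G) : E| by have /and3P[_ _] := hallE; rewrite pnatNK.
have ntE: E :!=: 1.
  by apply: contraNneq n_pF => E1; rewrite /pgroup -indexg1 -E1.
have pGE: p.-group (G / E).
  rewrite /pgroup card_quotient ?normal_norm //.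
  rewrite -(Lagrange_index (proper_sub ltFG) sEF) pnatM pFE andbT.
  by rewrite -card_quotient ?normal_norm.
have defZ: 'Z(G) = 'O_p(G).
  apply/eqP; rewrite eqEsubset (center_sub_pcore ltFG pGnF) /=.
  exact: pcore_sub_center pr_p vG nsEG ntE p'E pGE.
have pZ: p.-group 'Z(G) by rewrite defZ pcore_pgroup.
have sZF: 'Z(G) \subset 'F(G).
  by rewrite Fitting_max ?center_normal ?(pgroup_nil pZ).
have ltZF: 'Z(G) \proper 'F(G).
  by rewrite properEneq sZF andbT; apply: contraNneq n_pF => <-.
(* ['O_p(G)] is the [p]-part of ['F(G)], so dividing by the center leaves a [p']-group as kernel. *)
have hallZ: p.-Hall('F(G)) 'Z(G).
  by rewrite defZ -p_core_Fitting nilpotent_pcore_Hall ?Fitting_nil.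
have p'FZ: p^'.-group ('F(G) / 'Z(G)).
  have /and3P[_ _] := hallZ; rewrite -card_quotient //.
  exact: subset_trans (Fitting_sub G) (normal_norm (center_normal G)).
have /existsP[H frobH] :=
  Frobenius_p_elt_quotient nsFG (center_normal G) ltZF ltFG p'FZ pGnF.
exists p => //; split=> //; exists H; first exact: FrobeniusWcompl frobH.
have [defG _ _ _ _] := Frobenius_context frobH.
rewrite /pgroup (card_isog (sdprod_isog defG)).
by rewrite (card_isog (third_isog sZF (center_normal G) nsFG)).
Qed.

(** [Fitting_height3] for [G] gives [u < s]; for [G / 'F(G)] it gives [t = u], [v < t], and [s]
    equal to [t] or [v], which is absurd. *)
Lemma Fitting_quotient2_nil (gT : finGroupType) (G : {group gT}) :
    ppower_vanishing G -> solvable G -> ~~ nilpotent (G / 'F(G)) ->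
  nilpotent (G / 'F(G) / 'F(G / 'F(G))).
Proof.
move=> vG solG nnilGF; apply: contraT => nnilGF2.
have nsFG := Fitting_normal G; pose G1 := (G / 'F(G))%G.
have vG1: ppower_vanishing G1 by apply: ppower_vanishing_quotient.
have solG1: solvable G1 by apply: quotient_sol.
have [s [u [[pr_s pr_u ltus] sF2 uF3 _]]] := Fitting_height3 vG solG nnilGF.
have [t [v [[pr_t pr_v ltvt] tF3 _ piF2]]] := Fitting_height3 vG1 solG1 nnilGF2.
have ntF2: 'F(G1) != 1.
  by apply: contra nnilGF; rewrite trivg_Fitting // => /eqP->; apply: nilpotent1.
have ntF3: 'F(G1 / 'F(G1)) != 1.
  rewrite trivg_Fitting ?quotient_sol //.
  by apply: contra nnilGF2 => /eqP->; apply: nilpotent1.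
have tu: t = u.
  apply/eqP; apply: contraR ntF3 => ntu.
  by rewrite trivg_card1 (pnat_neq ntu tF3 uF3).
have [_ sdvd _] := pgroup_pdiv sF2 ntF2.
have := piF2 s pr_s sdvd; rewrite tu in ltvt *.
case/orP=> /eqP s_eq; rewrite s_eq ?ltnn // in ltus.
by have:= ltn_trans ltus ltvt; rewrite ltnn.
Qed.

Lemma Fitting_height3_nearly_two_Frobenius (gT : finGroupType) (G : {group gT}) :
    ppower_vanishing G -> solvable G -> ~~ nilpotent (G / 'F(G)) ->
  exists p q : nat, [/\ prime p, prime q, p != q, nearly_two_Frobenius G
    & \pi(G) =i pred2 p q].
Proof.
move=> vG solG nnilGF; have nilGF2 := Fitting_quotient2_nil vG solG nnilGF.
have nnilG: ~~ nilpotent G by apply: contra nnilGF; apply: quotient_nil.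
have [q [p [[pr_q pr_p ltpq] qF2 pF3 piF]]] := Fitting_height3 vG solG nnilGF.
have npq: p != q by rewrite neq_ltn ltpq.
have nqp: q != p by rewrite eq_sym.
have nsFG := Fitting_normal G; have nFG := subsetP (normal_norm nsFG).
pose G1 := (G / 'F(G))%G; pose S := 'F(G1)%G.
have vG1: ppower_vanishing G1 by apply: ppower_vanishing_quotient.
have solG1: solvable G1 by apply: quotient_sol.
have nsSG1: S <| G1 := Fitting_normal G1.
have ltSG1: S \proper G1.
  rewrite properE Fitting_sub; apply: contra nnilGF => sG1.
  exact: nilpotentS sG1 (Fitting_nil G1).
have ntS: S :!=: 1.
  by apply: contra nnilGF; rewrite trivg_Fitting // => /eqP->; apply: nilpotent1.
have pG1S: p.-group (G1 / S) by rewrite -(nilpotent_Fitting nilGF2).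
have [p1 [pr_p1 p1G1S vanG1 G1p1]] := Fitting_quotient_nil vG1 solG1 nnilGF nilGF2.
have G1p g : g \in G1 -> g \notin S -> p.-elt g.
  have <- : p1 = p; last exact: G1p1.
  apply/eqP; apply: contraT => np; have := pnat_neq np p1G1S pG1S.
  move/eqP; rewrite -trivg_card1 -subG1 quotient_sub1 ?normal_norm //.
  by move/negPf: (proper_subn ltSG1) => ->.
pose L := (coset 'F(G) @*^-1 S)%G.
have nsLG: L <| G by rewrite cosetpre_quotient_normal.
have sLG := normal_sub nsLG.
have sFL: 'F(G) \subset L by apply: sub_cosetpre.
have nsFL: 'F(G) <| L by apply: normalS sLG nsFG.
have defLF: L / 'F(G) = S by rewrite /= cosetpreK.
have memL g : g \in G -> (coset 'F(G) g \in S) = (g \in L).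
  by move=> Gg; rewrite -defLF mem_quotientE ?nFG.
have ltLG: L \proper G.
  rewrite properE sLG; apply: contra (proper_subn ltSG1) => sGL.
  by have:= quotientS 'F(G) sGL; rewrite defLF.
have ltFL: 'F(G) \proper L.
  by rewrite properE sFL -quotient_sub1 ?normal_norm // defLF subG1.
have Gp g : g \in G -> g \notin L -> p.-elt g.
  move=> Gg; rewrite -memL // => nSg; have G1g := mem_quotient 'F(G) Gg.
  apply: (@p_elt_lift _ 'F(G)) => //; first exact: nFG.
  - by apply: contra nSg => /coset_id->; apply: group1.
  - exact: G1p.
  by apply: vG => //; apply: vanishing_quotient nsFG Gg _; apply: vanG1.
have p'S: p^'.-group S by apply: sub_pgroup qF2 => r; rewrite !inE => /eqP->.
have frobGF: [Frobenius G / 'F(G) with kernel L / 'F(G)].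
  have p'LF: p^'.-group (L / 'F(G)) by rewrite defLF.
  exact: Frobenius_p_elt_quotient nsLG nsFG ltFL ltLG p'LF Gp.
have Fq g : g \in G -> coset 'F(G) g \in 'Z(S) -> g \notin 'F(G) -> q.-elt g.
  have [s [pr_s sF2 _ Fs]] := Fitting2_pgroup vG solG nnilG.
  have <- : s = q; last exact: Fs.
  apply/eqP; apply: contraR ntS => nsq.
  by rewrite trivg_card1 (pnat_neq nsq sF2 qF2).
have abS: abelian S.
  apply: (@Fitting2_abelian _ G q) => //.
    (* [q] is odd because the prime [p] is smaller. *)
    case: (even_prime pr_q) => // q2.
    by have:= prime_gt1 pr_p; rewrite ltnNge -ltnS -q2 ltpq.
  by rewrite -defLF.
have Lq g : g \in L -> g \notin 'F(G) -> q.-elt g.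
  move=> Lg nFg; have Gg := subsetP sLG g Lg; apply: Fq => //.
  by rewrite (center_idP abS) memL.
(* With this choice [L / F1] is a [q]-group while [G] consists of [p]-elements outside [L], and
   ['F(G) / F2] is a [q']-group while [L] consists of [q]-elements outside ['F(G)]. All the
   Frobenius quotients then come from [Frobenius_p_elt_quotient]. *)
pose F1 := 'O_p('F(G))%G; pose F2 := 'O_q('F(G))%G.
have defF12: F1 \x F2 = 'F(G).
  rewrite -[RHS](nilpotent_pcoreC p (Fitting_nil G)); congr (_ \x _); apply/esym.
  apply: eq_in_pcore => r; rewrite mem_primes => /and3P[pr_r _ rF].
  by case/orP: (piF r pr_r rF) => /eqP->; rewrite !inE ?eqxx ?(negPf npq) ?(negPf nqp).
have nsF1G: F1 <| G by rewrite gFnormal_trans.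
have nsF2G: F2 <| G by rewrite gFnormal_trans.
have sF1F: F1 \subset 'F(G) := pcore_sub _ _.
have sF2F: F2 \subset 'F(G) := pcore_sub _ _.
have qp' n : q.-nat n -> p^'.-nat n.
  by apply: sub_in_pnat => r _; rewrite !inE => /eqP->.
have qF1: q.-nat #|'F(G) : F1|.
  have /and3P[_ _] := nilpotent_pcore_Hall p (Fitting_nil G).
  apply: sub_in_pnat => r; rewrite mem_primes => /and3P[pr_r _ rF] p'r.
  have := piF r pr_r (dvdn_trans rF (dvdn_indexg _ _)).
  by rewrite (negPf p'r : r == p = false) orbF.
have q'F2: q^'.-nat #|'F(G) : F2|.
  by have /and3P[_ _] := nilpotent_pcore_Hall q (Fitting_nil G).
have qLF: q.-nat #|L : 'F(G)|.
  by rewrite -card_quotient ?normal_norm // defLF.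
have pGL: p.-nat #|G : L|.
  rewrite -(index_quotient_eq _ sLG (normal_norm nsFG)) ?subIset ?sFL ?orbT //.
  by move: pG1S; rewrite /pgroup card_quotient ?normal_norm // -defLF.
have ltF2F: F2 \proper 'F(G).
  rewrite properEneq sF2F andbT; apply: contraNneq ntS => defF2.
  by apply/eqP/(@Fitting2_trivg _ G q); rewrite // -defF2 pcore_pgroup.
have ltF1L: F1 \proper L := sub_proper_trans sF1F ltFL.
have nsF2L: F2 <| L by apply: normalS sLG nsF2G; apply: subset_trans sF2F sFL.
have sF2L := subset_trans sF2F sFL.
exists p, q; split=> //.
  exists 'F(G)%G, L, F1, F2; split=> //; first by rewrite Fitting_nil.
    apply: (Frobenius_p_elt_quotient nsLG nsF1G ltF1L ltLG _ Gp).
    rewrite /pgroup card_quotient ?(subset_trans sLG) ?normal_norm //.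
    by rewrite -(Lagrange_index sFL sF1F) pnatM !qp'.
  exists ('F(G) / F2)%G, (L / F2)%G; split; rewrite ?quotient_normal //.
    apply: (@Frobenius_p_elt_quotient _ _ _ _ p); rewrite ?quotient_normal //.
    - by rewrite quotient_proper // (normalS sF2F (Fitting_sub G)).
    - by rewrite quotient_proper // (normalS sF2L sLG).
    - rewrite /pgroup (card_isog (third_isog sF2F nsF2L nsFL)).
      by rewrite card_quotient ?normal_norm ?qp'.
    move=> _ /morphimP[g Ng Gg ->]; rewrite mem_quotientE ?(normalS sF2L sLG) //.
    by move/(Gp g Gg); apply: morph_p_elt.
  apply: (@Frobenius_p_elt_quotient _ _ _ _ q) => //.
  rewrite /pgroup card_quotient //.
  exact: subset_trans (Fitting_sub G) (normal_norm nsF2G).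
move=> r; rewrite !inE mem_primes cardG_gt0 /=.
apply/andP/orP=> [[pr_r] | rpq].
  rewrite -(Lagrange (Fitting_sub G)) -(Lagrange_index sLG sFL) !Euclid_dvdM //.
  case/or3P=> [/(piF r pr_r) | rGL | rLF]; first by rewrite orbC => /orP.
    by left; have:= pnat_dvd rGL pGL; rewrite pnatE.
  by right; have:= pnat_dvd rLF qLF; rewrite pnatE.
(* Both primes occur: [#|G : L|] is a nontrivial power of [p] and [#|L : 'F(G)|] one of [q]. *)
have pdvd (t : nat) (X Z : {group gT}) : Z \proper X -> t.-nat #|X : Z| ->
    prime t -> X \subset G -> t %| #|G|.
  move=> ltZX tXZ pr_t sXG; apply: dvdn_trans (cardSg sXG).
  apply: dvdn_trans (dvdn_indexg X Z); apply: contraT; rewrite -p'natE // => t'XZ.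
  by have := indexg_gt1 X Z; rewrite (pnat_1 tXZ t'XZ) (proper_subn ltZX).
by case: rpq => /eqP->; split=> //; [apply: (pdvd p G L) | apply: (pdvd q L 'F(G)%G)].
Qed.

Theorem theoremD (gT : finGroupType) (G : {group gT})
    (nabG : ~~ abelian G) (solG : solvable G)
    (vanG : forall (i : Iirr G) (g : gT), g \in G -> ('chi_i g = 0)%R ->
       exists2 r : nat, prime r & r.-elt g) :
  exists p q : nat, [/\ prime p, prime q, p != q &
    [\/ p.-group G,
        (exists2 H : {group coset_of 'Z(G)},
           [Frobenius G / 'Z(G) with complement H] & p.-group H)
        /\ 'Z(G) = 'O_p(G),
        (exists K H : {group gT},
           [/\ [Frobenius G = K ><| H], p.-group H & q.-group K])
        /\ \pi(G) =i pred2 p q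
      | nearly_two_Frobenius G /\ \pi(G) =i pred2 p q]].
Proof.
have vG: ppower_vanishing G by move=> g Gg [i]; apply: vanG.
(* In cases (i) and (ii) the second prime is an arbitrary one different from [p]. *)
have other_prime p : exists2 q, prime q & p != q.
  by have [->|n2] := eqVneq p 2; [exists 3 | exists 2].
have [nilG | nnilG] := boolP (nilpotent G).
  have [p pr_p pG] := nilpotent_ppower_vanishing vG nilG nabG.
  by have [q pr_q npq] := other_prime p; exists p, q; split=> //; constructor 1.
have [nilGF | nnilGF] := boolP (nilpotent (G / 'F(G))).
  have [p pr_p frobZ] := Fitting_quotient_nil_Frobenius vG solG nnilG nilGF.
  by have [q pr_q npq] := other_prime p; exists p, q; split=> //; constructor 2.
have [p [q [pr_p pr_q npq nearG piG]]] :=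
  Fitting_height3_nearly_two_Frobenius vG solG nnilGF.
by exists p, q; split=> //; constructor 4.
Qed.
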